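(* Let $P$ be the probability measure on $\{1,2,3,4,5,6\}\subset\mathbb{R}$ with probability mass function $f(j)=2^{-j}$ for $j\in\{1,2,3,4,5\}$ and $f(6)=2^{-5}$. The optimal set of five-means for $P$ is $\{1,2,3,4,a[5,6]\}$, with quantization error $V_5(P)=\frac{1}{64}$.
   Context: For a Borel probability measure $P$ on $\mathbb{R}$ and a nonempty finite set $\alpha\subset\mathbb{R}$, the distortion error is $V(P;\alpha)=\int\min_{a\in\alpha}|x-a|^2\,dP(x)$. The $n$th quantization error is $V_n(P)=\inf\{V(P;\alpha):\alpha\subset\mathbb{R},\ 1\le\mathrm{card}(\alpha)\le n\}$, and a set $\alpha$ with $1\le\mathrm{card}(\alpha)\le n$ attaining this infimum is called an optimal set of $n$-means for $P$. For $i\le j$ in $\{1,\dots,6\}$, $a[i,j]=\dfrac{\sum_{k=i}^{j}k f(k)}{\sum_{k=i}^{j}f(k)}$. *)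

(* Defs.v *)
From HB Require Import structures.
From mathcomp Require Import all_boot all_order all_algebra finmap.
From mathcomp Require Import all_classical all_reals all_analysis.
From mathcomp Require Import lra.

Set Implicit Arguments.
Unset Strict Implicit.
Unset Printing Implicit Defensive.
Import Order.TTheory GRing.Theory Num.Theory.

Local Open Scope classical_set_scope.
Local Open Scope ring_scope.

Section quantization.
Context {R : realType}.
Implicit Types (P : probability (measurableTypeR R) R) (alpha : {fset R}).

(* The neutral element +oo plays no role unless alpha is empty. *)
Definition min_sq_dist alpha (x : R) : \bar R :=
  \big[Order.min/+oo%E]_(a <- enum_fset alpha) ((`|x - a| ^+ 2)%:E).

Definition distortion P alpha : \bar R :=
  (\int[P]_x min_sq_dist alpha x)%E.

Definition admissible (n : nat) : set {fset R} :=
  [set alpha | (1 <= #|` alpha| <= n)%N].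

Definition quantization_error (n : nat) P : \bar R :=
  ereal_inf [set distortion P alpha | alpha in admissible n].

Definition optimal_set (n : nat) P alpha : Prop :=
  admissible n alpha /\ distortion P alpha = quantization_error n P.

End quantization.

Section example.
Variable R : realType.

Definition pmf (j : nat) : R :=
  if (1 <= j <= 5)%N then 2 ^- j else if j == 6%N then 2 ^- 5 else 0.

Lemma pmf_ge0 j : 0 <= pmf j.
Proof. by rewrite /pmf; do 2?case: ifP => // _; rewrite invr_ge0 exprn_ge0. Qed.

(* The weighted sum of Dirac masses \sum_(1 <= j <= 6) pmf j * \d_j. *)
Definition pmf_measure : set (measurableTypeR R) -> \bar R :=
  msum (fun k => mscale (NngNum (pmf_ge0 k.+1))
                        (@dirac _ (measurableTypeR R) k.+1%:R R)) 6.

HB.instance Definition _ := Measure.on pmf_measure.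

Lemma pmf_measureE (A : set (measurableTypeR R)) :
  pmf_measure A = (\sum_(k < 6) (pmf k.+1 * \1_A (k.+1%:R : R))%:E)%E.
Proof. by []. Qed.

Lemma pmf_measure_setT : pmf_measure setT = 1%E.
Proof.
rewrite pmf_measureE sumEFin; congr EFin.
under eq_bigr do rewrite indicT mulr1.
rewrite !big_ord_recr big_ord0 /pmf /=; lra.
Qed.

HB.instance Definition _ :=
  Measure_isProbability.Build _ _ _ pmf_measure pmf_measure_setT.

Lemma pmf_measure1 j : (1 <= j <= 6)%N ->
  pmf_measure [set j%:R] = (pmf j)%:E.
Proof.
case: j => // j; rewrite ltnS /= => j6.
rewrite pmf_measureE (bigD1 (Ordinal j6)) //= indicE mem_set // mulr1.
rewrite big1 ?adde0// => i ij; rewrite indicE memNset ?mulr0// => /eqP.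
by rewrite eqr_nat eqSS; apply/negP.
Qed.

Definition cmean (i j : nat) : R :=
  (\sum_(i <= k < j.+1) k%:R * pmf k) / (\sum_(i <= k < j.+1) pmf k).

End example.

Arguments pmf_measure R A : clear implicits.
Arguments cmean R i j : clear implicits.

(* Main.v *)
Require Import Defs.
From HB Require Import structures.
From mathcomp Require Import all_boot all_order all_algebra finmap.
From mathcomp Require Import all_classical all_reals all_analysis.
From mathcomp Require Import measurable_realfun zify ring lra.
Import Order.TTheory GRing.Theory Num.Theory.
(* [pmf] and [pmf_ge0] would otherwise be those of MathComp-Analysis. *)
Import Defs.
Local Open Scope ring_scope.

(** Send each of the six atoms to a nearest point of [alpha]. As [alpha] has at
    most five points, two atoms [i < j] share a point, and their joint
    contribution is at least [f(i) f(j) / (f(i) + f(j)) (j - i)^2 >= 1/64], with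
    equality only if [f(i) = f(j) = 2^-5] and [j = i + 1], i.e. for the atoms 5
    and 6 served by their midpoint. Then the other atoms contribute nothing, so
    they belong to [alpha]. *)

Section min_sq_dist.
Context {R : realType}.
Implicit Types (alpha : {fset R}) (x a : R).

Lemma min_sq_dist_ge0 alpha x : (0 <= min_sq_dist alpha x)%E.
Proof. by apply: le_bigmin => [|a _]; rewrite ?leey// lee_fin exprn_ge0. Qed.

Lemma min_sq_dist_le alpha x a : a \in alpha ->
  (min_sq_dist alpha x <= ((x - a) ^+ 2)%:E)%E.
Proof.
move=> aA; rewrite /min_sq_dist -[((x - a) ^+ 2)]real_normK ?num_real//.
exact: (@ge_bigmin_seq _ _ _ _ _ a xpredT
  (fun a => (`|x - a| ^+ 2)%:E : \bar R)).
Qed.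

(** A minimum over a finite list is one of its terms, unless the list is empty and the default [+oo]
    is left. *)
Lemma min_sq_dist_attained alpha x : (0 < #|` alpha|)%N ->
  exists2 a, a \in alpha & min_sq_dist alpha x = ((x - a) ^+ 2)%:E.
Proof.
(* The inclusion is carried through the induction so that a minimizer in a sublist is still a point
   of [alpha]. *)
rewrite /min_sq_dist; have : {subset enum_fset alpha <= alpha} by [].
elim: (enum_fset alpha) => [//|b s IHs] sA _.
have bA : b \in alpha by rewrite sA// mem_head.
rewrite big_cons real_normK ?num_real//.
case: s IHs sA => [_ _|b' s IHs sA]; first by rewrite big_nil miney; exists b.
have [|//|a aA ->] := IHs; first by move=> x' x's; rewrite sA// inE x's orbT.
by rewrite -EFin_min minEle; case: ifP => _; [exists b|exists a].
Qed.

Lemma measurable_min_sq_dist alpha :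
  measurable_fun [set: measurableTypeR R]
    (fun x : measurableTypeR R => min_sq_dist alpha x : \bar R).
Proof.
rewrite /min_sq_dist; elim: (enum_fset alpha) => [|a s IHs].
  by under eq_fun do rewrite big_nil; exact: measurable_cst.
under eq_fun do rewrite big_cons.
apply: measurable_mine IHs; apply/measurable_EFinP.
apply: measurable_funX; apply: measurableT_comp => //.
exact: measurable_funB.
Qed.
End min_sq_dist.

Section atoms.
Context (R : realType).

(** The integral of a nonnegative measurable function is additive in the measure, and a Dirac mass
    evaluates it at its atom. *)
Lemma distortion_pmf_measure (alpha : {fset R}) :
  distortion (pmf_measure R) alpha =
  (\sum_(k < 6) (pmf R k.+1)%:E * min_sq_dist alpha k.+1%:R)%E.
Proof.
have mA := measurable_min_sq_dist alpha.
have A0 x : [set: R]%classic x -> (0 <= min_sq_dist alpha x)%E.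
  by move=> _; exact: min_sq_dist_ge0.
rewrite /distortion.
have -> := ge0_integral_measure_sum (fun k => mscale (NngNum (pmf_ge0 R k.+1))
  (@dirac _ (measurableTypeR R) k.+1%:R R)) measurableT A0 mA 6.
apply: eq_bigr => k _; rewrite ge0_integral_mscale//= integral_dirac//.
by rewrite diracT mul1e.
Qed.

Lemma pmf_ge k : (k < 6)%N -> 1 / 32 <= pmf R k.+1.
Proof. by rewrite /pmf; do 6 (case: k => [_|k] /=; first lra). Qed.

Lemma pmf_ge_lt4 k : (k < 4)%N -> 1 / 16 <= pmf R k.+1.
Proof. by rewrite /pmf; do 4 (case: k => [_|k] /=; first lra). Qed.

(** For [p = 1 / 16], [q = 1 / 32] and [v - u = 1] the least cost is [p * q / (p + q) = 1 / 48], so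
    the inequality is strict. *)
Lemma two_point_cost (p q u v : R) : 1 / 16 <= p -> 1 / 32 <= q -> 1 <= v - u ->
  1 / 64 < p * u ^+ 2 + q * v ^+ 2.
Proof.
move=> p16 q32 uv.
have pu : 1 / 16 * u ^+ 2 <= p * u ^+ 2 by rewrite ler_wpM2r// sqr_ge0.
have qv : 1 / 32 * v ^+ 2 <= q * v ^+ 2 by rewrite ler_wpM2r// sqr_ge0.
have uv2 : 1 <= (v - u) ^+ 2 by rewrite expr_ge1// (le_trans _ uv).
(* [3 (2 u^2 + v^2) = 2 (v - u)^2 + (2 u + v)^2] *)
have := sqr_ge0 (2 * u + v); nra.
Qed.

(** Index [k] stands for the atom [k.+1], served by [c k], which may be any real. *)
Definition assignment_cost (c : 'I_6 -> R) : R :=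
  \sum_(k < 6) pmf R k.+1 * (k.+1%:R - c k) ^+ 2.

Lemma assignment_cost_gt (c : 'I_6 -> R) (i j : 'I_6) :
  (i < j)%N -> (i < 4)%N -> c i = c j -> 1 / 64 < assignment_cost c.
Proof.
move=> ij i4 cij; rewrite /assignment_cost (bigD1 i)//= (bigD1 j)/=; last first.
  by rewrite -val_eqE neq_ltn ij orbT.
rewrite addrA ltr_wpDr//.
  by apply: sumr_ge0 => k _; rewrite mulr_ge0 ?sqr_ge0 ?pmf_ge0.
apply: two_point_cost; rewrite ?pmf_ge_lt4 ?pmf_ge// cij.
have : i.+1%:R + 1 <= j.+1%:R :> R by rewrite natr1 ler_nat.
lra.
Qed.

Lemma assignment_cost_min (c : 'I_6 -> R) : ~ injective c ->
  1 / 64 <= assignment_cost c /\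
  (assignment_cost c = 1 / 64 ->
   forall k, c k = if (k < 4)%N then k.+1%:R else 11 / 2).
Proof.
move=> /injectiveP/injectivePn[i [j]].
wlog ij : i j / (i < j)%N => [hwlog ij cij|_ cij].
  have /orP[lt_ij|lt_ji] : (i < j)%N || (j < i)%N by rewrite -neq_ltn.
    exact: (hwlog i j).
  by apply: (hwlog j i); rewrite // eq_sym.
(* Either the smaller atom is at most 4 and the bound is strict, or the shared pair is the atoms 5
   and 6. *)
have [i4|i4] := ltnP i 4.
  have h := assignment_cost_gt _ _ _ ij i4 cij.
  by split=> [|hc]; [exact: ltW|move: h; rewrite hc ltxx].
have i4E : i = inord 4.
  by apply/val_inj; rewrite /= inordK//; have := ltn_ord j; lia.
have j5E : j = inord 5.
  by apply/val_inj; rewrite /= inordK//; have := ltn_ord j; lia.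
(* With [y] serving both 5 and 6, completing the square turns [((5 - y)^2 + (6 - y)^2) / 32] into
   the last bracket. *)
have -> : assignment_cost c =
    1 / 2 * (1 - c (inord 0)) ^+ 2 + 1 / 4 * (2 - c (inord 1)) ^+ 2
    + 1 / 8 * (3 - c (inord 2)) ^+ 2 + 1 / 16 * (4 - c (inord 3)) ^+ 2
    + (1 / 16 * (11 / 2 - c (inord 4)) ^+ 2 + 1 / 64).
  rewrite /assignment_cost; under eq_bigr => k _ do rewrite -[k in c k]inord_val.
  rewrite !big_ord_recr big_ord0 /pmf /= -j5E -cij -i4E.
  by field.
have sq_eq (x y : R) : (x - y) ^+ 2 = 0 -> y = x.
  by move=> /eqP; rewrite sqrf_eq0 subr_eq0 => /eqP.
move: (sqr_ge0 (1 - c (inord 0))) (sqr_ge0 (2 - c (inord 1)))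
      (sqr_ge0 (3 - c (inord 2))) (sqr_ge0 (4 - c (inord 3)))
      (sqr_ge0 (11 / 2 - c (inord 4))).
move=> s0 s1 s2 s3 s4; split=> [|hc k]; first lra.
have c0 : c (inord 0) = 1 by apply: sq_eq; lra.
have c1 : c (inord 1) = 2 by apply: sq_eq; lra.
have c2 : c (inord 2) = 3 by apply: sq_eq; lra.
have c3 : c (inord 3) = 4 by apply: sq_eq; lra.
have c4 : c (inord 4) = 11 / 2 by apply: sq_eq; lra.
rewrite -[k in LHS]inord_val.
case: k => k /=; do 4 (case: k => [_|k] //=); case: k => [_|[_|//]] //=.
(* The last index takes its value from index 4, with which it shares its point. *)
by rewrite -j5E -cij i4E.
Qed.

Lemma distortion_lower_bound (alpha : {fset R}) : admissible 5 alpha ->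
  ((1 / 64)%:E <= distortion (pmf_measure R) alpha)%E /\
  (distortion (pmf_measure R) alpha = (1 / 64)%:E ->
   [fset 1; 2; 3; 4; 11 / 2]%fset = alpha).
Proof.
move=> /andP[alpha_gt0 alpha_le5].
have /choice[c cP] (k : 'I_6) : exists a, a \in alpha /\
    min_sq_dist alpha k.+1%:R = ((k.+1%:R - a) ^+ 2)%:E.
  by have [a aA ->] := min_sq_dist_attained alpha k.+1%:R alpha_gt0; exists a.
have -> : distortion (pmf_measure R) alpha = (assignment_cost c)%:E.
  rewrite distortion_pmf_measure /assignment_cost -sumEFin.
  by apply: eq_bigr => k _; rewrite (cP k).2 EFinM.
(* Pigeonhole: six indices are sent into at most five points. *)
have c_ninj : ~ injective c.
  move=> c_inj.
  have : (size (map c (enum 'I_6)) <= #|` alpha|)%N.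
    apply: uniq_leq_size; first by rewrite map_inj_uniq ?enum_uniq.
    by move=> _ /mapP[k _ ->]; exact: (cP k).1.
  by rewrite size_map size_enum_ord leqNgt (leq_ltn_trans alpha_le5).
have [cost_ge cost_eq] := assignment_cost_min c c_ninj.
split=> [|[/cost_eq cE]]; first by rewrite lee_fin.
(* The equality case puts the five points in [alpha]; since [alpha] has at most five elements, there
   are no others. *)
apply/eqP; rewrite eqEfcard; apply/andP; split.
  apply/fsubsetP => x; rewrite !inE.
  have cA (k : 'I_6) : (if (k < 4)%N then k.+1%:R else 11 / 2) \in alpha.
    by rewrite -cE; exact: (cP k).1.
  move=> /orP[/orP[/orP[/orP[]|]|]|] /eqP ->.
  - by have := cA (inord 0); rewrite inordK.
  - by have := cA (inord 1); rewrite inordK.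
  - by have := cA (inord 2); rewrite inordK.
  - by have := cA (inord 3); rewrite inordK.
  - by have := cA (inord 4); rewrite inordK.
(* The listed reals increase strictly, so they are five distinct points. *)
rewrite (leq_trans alpha_le5)// (@uniq_leq_size _ [:: 1; 2; 3; 4; 11 / 2])//.
  by apply: lt_sorted_uniq; rewrite /=; do ?[apply/andP; split]; lra.
by move=> x; rewrite !inE -!orbA.
Qed.

Lemma distortion_upper_bound :
  (distortion (pmf_measure R) [fset 1; 2; 3; 4; 11 / 2]%fset%R <= (1 / 64)%:E)%E.
Proof.
(* The cost of this explicit assignment bounds the distortion, as each minimum is at most the
   squared distance to [c k]. *)
pose c (k : 'I_6) : R := if (k < 4)%N then k.+1%:R else 11 / 2.
have -> : 1 / 64 = \sum_(k < 6) pmf R k.+1 * (k.+1%:R - c k) ^+ 2.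
  by rewrite !big_ord_recr big_ord0 /pmf /c /=; field.
rewrite distortion_pmf_measure -sumEFin; apply: lee_sum => k _.
rewrite EFinM lee_wpmul2l ?lee_fin ?pmf_ge0// min_sq_dist_le//.
rewrite !inE /c; case: k => k /=.
by do 4 (case: k => [_|k] /=; first by rewrite eqxx ?orbT); rewrite eqxx orbT.
Qed.

Lemma cmean56 : cmean R 5 6 = 11 / 2.
Proof. by rewrite /cmean /index_iota /= !big_cons !big_nil /pmf /=; field. Qed.
End atoms.

Theorem proposition3p5 (R : realType) :
  (forall alpha : {fset R},
     optimal_set 5 (pmf_measure R) alpha <->
     alpha = [fset 1; 2; 3; 4; cmean R 5 6]%fset) /\
  quantization_error 5 (pmf_measure R) = (1 / 64)%:E.
Proof.
rewrite cmean56; set beta := [fset 1; 2; 3; 4; 11 / 2]%fset.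
have beta_adm : admissible 5 beta.
  apply/andP; split; first by rewrite cardfs_gt0; apply/fset0Pn; exists 1;
    rewrite !inE eqxx.
  have sb : {subset beta <= [:: 1; 2; 3; 4; 11 / 2]}.
    by move=> x; rewrite !inE -!orbA.
  exact: (uniq_leq_size (fset_uniq beta) sb).
have betaE : distortion (pmf_measure R) beta = (1 / 64)%:E.
  apply/eqP; rewrite eq_le distortion_upper_bound.
  by have [-> _] := distortion_lower_bound R _ beta_adm.
have V5 : quantization_error 5 (pmf_measure R) = (1 / 64)%:E.
  apply/eqP; rewrite eq_le; apply/andP; split.
    by rewrite -betaE; apply: ereal_inf_lbound; exists beta.
  apply: le_ereal_inf_tmp => _ [alpha /(distortion_lower_bound R)[h _] <-].
  exact: h.
(* Uniqueness is the equality case of the lower bound; the converse is [beta_adm] with [betaE]. *)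
split=> // alpha; rewrite /optimal_set V5; split=> [[adm hV]|->//].
by have [_ /(_ hV)] := distortion_lower_bound R _ adm.
Qed.
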